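(* Suppose $S$ is a finitely generated inverse semigroup which is effectively $F$-inverse, and whose maximal group image has decidable word problem. Then $S$ has recursively bounded group distortion.
   Context: An inverse semigroup is a semigroup $S$ in which every $s$ has a unique $s^{-1}$ with $ss^{-1}s=s$ and $s^{-1}ss^{-1}=s^{-1}$. The natural partial order is $s\le t$ iff $s=te$ for some idempotent $e$. Elements $s,t$ are $\mathcal{R}$-related iff $ss^{-1}=tt^{-1}$. The maximal group image is $G=S/\sigma$, where $\sigma$ is the least congruence identifying all idempotents; $\sigma\colon S\to G$ also denotes the natural homomorphism. $S$ is $F$-inverse if every $\sigma$-class has a maximum element in the natural partial order (such an $S$ is necessarily an $E$-unitary inverse monoid); the maximum of the $\sigma$-class of $s$ is denoted $s^{\mathfrak m}$. For a word $w\in(X\cup X^{-1})^*$ over a generating set $X$, $[w]_S$ is the element of $S$ it represents. A finitely generated inverse semigroup $S=\langle X\rangle$ ($X$ finite) is effectively $F$-inverse if it is $F$-inverse and there is an algorithm which, on input a word $w\in(X\cup X^{-1})^*$, outputs a word representing $[w]_S^{\mathfrak m}$. Word metric: the Cayley graph of $S$ has vertex set $S$ and edges $s\xrightarrow{x}sx$ ($x\in X\cup X^{-1}$); its strongly connected components have the $\mathcal{R}$-classes as vertex sets. For $\mathcal{R}$-related $s,t$, $d_S(s,t)$ is the path distance in this component; otherwise $d_S(s,t)=\infty$. The corresponding length function is $l_S(s)=d_S(ss^{-1},s)$; $l_G$ is the word length on $G$ with respect to the image of $X$. $S$ has recursively bounded group distortion if (for the word lengths $l_S$ and $l_G$ with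 respect to a fixed finite generating set of $S$ and the corresponding generating set of $G$) there is a recursive function $\phi\colon\mathbb{N}\to\mathbb{N}$ such that $l_S(s)\le\phi(l_G(\sigma(s)))$ for every $s\in S$. *)

(* Defs.v *)
From HB Require Import structures.
From mathcomp Require Import all_boot all_fingroup generic_quotient.
From mathcomp Require Import boolp.

Set Implicit Arguments.
Unset Strict Implicit.
Unset Printing Implicit Defensive.

Local Open Scope group_scope.
Local Open Scope quotient_scope.

(* Partial recursive functions nat^n -> nat: zero, successor, projections,    *)
(* composition, primitive recursion (on the first argument), minimisation.    *)
Inductive murec : nat -> Type :=
| MZero n : murec n
| MSucc : murec 1
| MProj n (i : 'I_n) : murec n
| MComp n m (f : murec m) (g : 'I_m -> murec n) : murec n
| MPrec n (f : murec n) (g : murec n.+2) : murec n.+1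
| MMin n (f : murec n.+1) : murec n.

(* [computes c v r]: the function with code c is defined at v, with value r.  *)
(* For MPrec, u is the sequence of intermediate values of the recursion.      *)
Fixpoint computes n (c : murec n) : n.-tuple nat -> nat -> Prop :=
  match c with
  | MZero _ => fun _ r => r = 0
  | MSucc => fun v r => r = (thead v).+1
  | MProj _ i => fun v r => r = tnth v i
  | MComp _ m f g => fun v r =>
      exists2 u : m.-tuple nat,
        forall i, computes (g i) v (tnth u i) & computes f u r
  | MPrec _ f g => fun v r =>
      exists u : nat -> nat,
        [/\ computes f [tuple of behead v] (u 0),
            forall k, (k < thead v)%N ->
              computes g [tuple of k :: u k :: behead v] (u k.+1)
          & r = u (thead v)]
  | MMin _ f => fun v r =>
      computes f [tuple of r :: v] 0 /\
      forall k, (k < r)%N -> exists j, computes f [tuple of k :: v] j.+1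
  end.

Definition recursive (h : nat -> nat) : Prop :=
  exists c : murec 1, forall k, computes c [tuple k] (h k).

(* Words over X \cup X^-1, |X| = n: (i, false) is the generator x_i and       *)
(* (i, true) its formal inverse.                                              *)
Definition letter n : finType := ('I_n * bool)%type.
Definition word n := seq (letter n).

(* Bijective base-2n numeration; for n > 0 every natural number is the code   *)
(* of exactly one word.                                                       *)
Definition word_code n (w : word n) : nat :=
  foldr (fun (a : letter n) m => ((a.1.*2 + a.2).+1 + n.*2 * m)%N) 0 w.

Definition computable_word_map n (f : word n -> word n) : Prop :=
  exists2 h, recursive h & forall w, h (word_code w) = word_code (f w).

Definition computable_word_pred n (P : pred (word n)) : Prop :=
  exists2 h, recursive h & forall w, h (word_code w) = P w.

Definition least (P : nat -> Prop) : option nat :=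
  if pselect (exists k, `[< P k >]) is left exP then Some (ex_minn exP)
  else None.

(* Semigroups are non-empty.                                                  *)
HB.mixin Record Semigroup_isInverse S of Semigroup S := {
  sinv : S -> S;
  sinv_mulK : forall s, s * sinv s * s = s;
  sinv_mulVK : forall s, sinv s * s * sinv s = sinv s;
  sinv_unique : forall s t, s * t * s = s -> t * s * t = t -> t = sinv s;
  semigroup_inhabited : inhabited S
}.

#[short(type="inverseSemigroupType")]
HB.structure Definition InverseSemigroup :=
  {S of Semigroup_isInverse S & Semigroup S}.

Section InverseSemigroup.
Variable S : inverseSemigroupType.
Implicit Types (s t e f : S) (R : S -> S -> Prop).

Definition is_idem e : Prop := e * e = e.

Definition nat_le s t : Prop := exists2 e, is_idem e & s = t * e.

Definition Rrel s t : bool := s * sinv s == t * sinv t.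

Definition congruence R : Prop :=
  [/\ forall s, R s s,
      forall s t, R s t -> R t s,
      forall s t u, R s t -> R t u -> R s u
    & forall s t s' t', R s t -> R s' t' -> R (s * s') (t * t')].

Definition sigma_rel s t : Prop :=
  forall R, congruence R -> (forall e f, is_idem e -> is_idem f -> R e f) ->
  R s t.

Lemma sigma_rel_congruence : congruence sigma_rel.
Proof.
split.
- by move=> s R [rR _ _ _] _.
- by move=> s t st R cR iR; case: (cR) => _ sR _ _; apply: (sR s t (st R cR iR)).
- move=> s t u st tu R cR iR; case: (cR) => _ _ tR _.
  exact: tR (st R cR iR) (tu R cR iR).
- move=> s t s' t' st st' R cR iR; case: (cR) => _ _ _ mR.
  exact: mR (st R cR iR) (st' R cR iR).
Qed.

Lemma sigma_rel_idem e f : is_idem e -> is_idem f -> sigma_rel e f.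
Proof. by move=> ie if_ R _ iR; apply: iR. Qed.

Definition sigma_relb : rel S := fun s t => `[< sigma_rel s t >].

Lemma sigma_relb_refl : reflexive sigma_relb.
Proof. by move=> s; apply/asboolP; case: sigma_rel_congruence. Qed.

Lemma sigma_relb_sym : symmetric sigma_relb.
Proof.
case: sigma_rel_congruence => _ sR _ _ s t.
by apply/asboolP/asboolP; apply: sR.
Qed.

Lemma sigma_relb_trans : transitive sigma_relb.
Proof.
case: sigma_rel_congruence => _ _ tR _ t s u /asboolP st /asboolP tu.
by apply/asboolP; apply: (tR _ _ _ st tu).
Qed.

Canonical sigma_equiv :=
  EquivRel sigma_relb sigma_relb_refl sigma_relb_sym sigma_relb_trans.

Definition max_group_image : Type := {eq_quot sigma_equiv}.
HB.instance Definition _ := Choice.on max_group_image.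

Definition sigma s : max_group_image :=
  \pi_{eq_quot sigma_equiv} s.

Lemma sigmaP s t : sigma s = sigma t <-> sigma_rel s t.
Proof.
split=> [/eqmodP/asboolP//|st]; exact/eqmodP/asboolP.
Qed.

Definition mgi_repr (g : max_group_image) : S :=
  repr (g : {eq_quot sigma_equiv}).

Definition mgi_mul (g h : max_group_image) := sigma (mgi_repr g * mgi_repr h).
Definition mgi_inv (g : max_group_image) := sigma (sinv (mgi_repr g)).
Definition mgi_one :=
  let s := inhabited_witness (@semigroup_inhabited S) in sigma (s * sinv s).

Lemma sigma_repr (g : max_group_image) : sigma (mgi_repr g) = g.
Proof. exact: reprK. Qed.

Lemma sigma_mul s t : sigma (s * t) = mgi_mul (sigma s) (sigma t).
Proof.
apply/sigmaP; case: sigma_rel_congruence => _ _ _; apply.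
- by apply/sigmaP; rewrite sigma_repr.
- by apply/sigmaP; rewrite sigma_repr.
Qed.

Lemma sinv_idem s : is_idem (s * sinv s).
Proof. by rewrite /is_idem mulgA sinv_mulK. Qed.

Lemma sinv_idemV s : is_idem (sinv s * s).
Proof. by rewrite /is_idem mulgA sinv_mulVK. Qed.

Lemma sigma_idem e : is_idem e -> sigma e = mgi_one.
Proof.
move=> ie; rewrite /mgi_one /=; apply/sigmaP.
by apply: sigma_rel_idem => //; apply: sinv_idem.
Qed.

Lemma mgi_mulA : associative mgi_mul.
Proof.
move=> g h k; rewrite -(sigma_repr g) -(sigma_repr h) -(sigma_repr k).
by rewrite -!sigma_mul mulgA.
Qed.

Lemma mgi_mul1 : left_id mgi_one mgi_mul.
Proof.
move=> g; rewrite -(sigma_repr g) -(sigma_idem (sinv_idem (mgi_repr g))).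
by rewrite -sigma_mul sinv_mulK.
Qed.

Lemma mgi_mulg1 : right_id mgi_one mgi_mul.
Proof.
move=> g; rewrite -(sigma_repr g) -(sigma_idem (sinv_idemV (mgi_repr g))).
by rewrite -sigma_mul mulgA sinv_mulK.
Qed.

Lemma mgi_mulV : left_inverse mgi_one mgi_inv mgi_mul.
Proof.
move=> g; rewrite -{2}(sigma_repr g) -sigma_mul.
exact/sigma_idem/sinv_idemV.
Qed.

Lemma mgi_mulgV : right_inverse mgi_one mgi_inv mgi_mul.
Proof.
move=> g; rewrite -{1}(sigma_repr g) -sigma_mul.
exact/sigma_idem/sinv_idem.
Qed.

HB.instance Definition _ := isGroup.Build max_group_image
  mgi_mulA mgi_mul1 mgi_mulg1 mgi_mulV mgi_mulgV.

HB.instance Definition _ := isMultiplicative.Build S max_group_image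
  sigma sigma_mul.

Definition sigma_max s m : Prop :=
  sigma s = sigma m /\ forall t, sigma s = sigma t -> nat_le t m.

Definition F_inverse : Prop := forall s, exists m, sigma_max s m.

Variables (n : nat) (x : 'I_n -> S).

Definition letter_val (a : letter n) : S :=
  if a.2 then sinv (x a.1) else x a.1.

(* [w]_S = s; the empty word represents the identity of S, if there is one.   *)
Definition represents (w : word n) s : Prop :=
  if w is a :: w' then
    foldl (fun t b => t * letter_val b) (letter_val a) w' = s
  else forall t, s * t = t /\ t * s = t.

Definition generates : Prop := forall s, exists w, represents w s.

Definition effectively_F_inverse : Prop :=
  F_inverse /\
  exists2 f : word n -> word n, computable_word_map f &
    forall w s m, represents w s -> sigma_max s m -> represents (f w) m.

Definition cayley_edge : rel S :=
  fun s t => [exists a, t == s * letter_val a].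

(* None stands for infinity.                                                  *)
Definition word_dist s t : option nat :=
  if Rrel s t then
    least (fun k => exists p : seq S,
      [/\ path (fun u v => [&& cayley_edge u v, Rrel s u & Rrel s v]) s p,
          last s p = t & size p = k])
  else None.

Definition word_length s : option nat := word_dist (s * sinv s) s.

End InverseSemigroup.

Section Group.
Variables (G : groupType) (n : nat) (y : 'I_n -> G).

Definition group_word_val (w : word n) : G :=
  foldr (fun (a : letter n) g => (if a.2 then (y a.1)^-1 else y a.1) * g) 1 w.

Definition group_generates : Prop := forall g, exists w, group_word_val w = g.

Definition group_word_length (g : G) : option nat :=
  least (fun k => exists2 w, group_word_val w = g & size w = k).

End Group.

(* For a finitely generated group this does not depend on the generators.     *)
Definition decidable_word_problem (G : groupType) : Prop :=
  exists n (y : 'I_n -> G), group_generates y /\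
    computable_word_pred (fun w => group_word_val y w == 1).

Definition recursively_bounded_group_distortion
    (S : inverseSemigroupType) n (x : 'I_n -> S) : Prop :=
  exists2 phi, recursive phi &
    forall s, exists k l,
      [/\ word_length x s = Some k,
          group_word_length (fun i => sigma (x i)) (sigma s) = Some l
        & (k <= phi l)%N].

(* Main.v *)
(** Let [f] compute maxima on words.  If [u] is a shortest word representing
    [sigma s] in [G], then [f u] represents the maximum [m] of the sigma-class
    of [s].  As [s <= m] gives [s = s s^-1 m], the word [f u] also labels a path
    from [s s^-1] to [s], and this path cannot leave the R-class.  So
    [l_S s <= |f u|], and it suffices to bound [|f u|] recursively in [|u|]:
    the code of a word is at least its length, and only the codes up to a
    recursive bound belong to words of length [|u|]. *)
Require Import Defs.
From mathcomp Require Import all_boot all_fingroup.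
From mathcomp Require Import boolp.

Set Implicit Arguments.
Unset Strict Implicit.
Unset Printing Implicit Defensive.

Lemma least_le (P : nat -> Prop) k :
  P k -> exists l, [/\ least P = Some l, P l & (l <= k)%N].
Proof.
move=> Pk; rewrite /least; case: pselect => [exP|[]]; last first.
  by exists k; apply/asboolP.
case: ex_minnP => l /asboolP Pl minl; exists l; split=> //.
exact/minl/asboolP.
Qed.

(** * Closure properties of total recursive functions *)

Definition total_recursive n (F : n.-tuple nat -> nat) : Prop :=
  exists c : murec n, forall v, computes c v (F v).

Lemma recursiveP (h : nat -> nat) :
  recursive h <-> total_recursive (fun v : 1.-tuple nat => h (thead v)).
Proof.
split=> -[c cP]; exists c; last by move=> k; apply: cP.
move=> v; have -> : v = [tuple thead v] by case/tupleP: v => k v; rewrite tuple0.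
exact: cP.
Qed.

Lemma eq_total_recursive n (F F' : n.-tuple nat -> nat) :
  F =1 F' -> total_recursive F -> total_recursive F'.
Proof. by move=> FF' [c cP]; exists c => v; rewrite -FF'. Qed.

Lemma total_recursive_proj n (i : 'I_n) :
  total_recursive (fun v : n.-tuple nat => tnth v i).
Proof. by exists (MProj i). Qed.

Lemma total_recursive_comp n m (F : m.-tuple nat -> nat)
    (G : 'I_m -> n.-tuple nat -> nat) :
  total_recursive F -> (forall i, total_recursive (G i)) ->
  total_recursive (fun v => F [tuple G i v | i < m]).
Proof.
move=> [c cP] /choice[d dP]; exists (MComp c d) => v /=.
by exists [tuple G i v | i < m] => // i; rewrite tnth_mktuple.
Qed.

Lemma total_recursive_comp1 n (h : nat -> nat) (G : n.-tuple nat -> nat) :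
  recursive h -> total_recursive G -> total_recursive (fun v => h (G v)).
Proof.
move=> /recursiveP hr Gr.
apply: eq_total_recursive (total_recursive_comp hr (fun=> Gr)) => v.
by rewrite /thead tnth_mktuple.
Qed.

Lemma total_recursive_prec n (F : n.-tuple nat -> nat)
    (G : n.+2.-tuple nat -> nat) :
  total_recursive F -> total_recursive G ->
  total_recursive (fun v : n.+1.-tuple nat =>
    nat_rect (fun=> nat) (F [tuple of behead v])
      (fun k u => G [tuple of k :: u :: behead v]) (thead v)).
Proof.
move=> [c cP] [d dP]; exists (MPrec c d) => v /=.
exists (nat_rect (fun=> nat) (F [tuple of behead v])
  (fun k u => G [tuple of k :: u :: behead v])).
by split=> // k _; apply: dP.
Qed.

Lemma recursive_succ : recursive succn.
Proof. by exists MSucc. Qed.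

Definition recursive2 (h : nat -> nat -> nat) : Prop :=
  total_recursive (fun v : 2.-tuple nat => h (thead v) (tnth v ord_max)).

Lemma total_recursive_comp2 n h (F G : n.-tuple nat -> nat) :
  recursive2 h -> total_recursive F -> total_recursive G ->
  total_recursive (fun v => h (F v) (G v)).
Proof.
move=> hr Fr Gr.
have FGr (i : 'I_2) : total_recursive (if i == ord0 then F else G).
  by case: ifP.
apply: eq_total_recursive (total_recursive_comp hr FGr) => v.
by rewrite /thead !tnth_mktuple.
Qed.

Lemma recursive2_add : recursive2 addn.
Proof.
(* Recursion on the first summand: the base value is the second one, and the step takes the
   successor of coordinate 1, which holds the previous value. *)
have pr := total_recursive_prec (total_recursive_proj (ord0 : 'I_1))
  (total_recursive_comp1 recursive_succ
    (total_recursive_proj (lift ord0 ord0 : 'I_3))).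
apply: eq_total_recursive pr => v; case/tupleP: v => k v; case/tupleP: v => l v.
rewrite theadE [tnth _ ord_max](tnth_nth 0) /=.
elim: k => [|k IHk]; first by rewrite (tnth_nth 0).
by rewrite /= IHk.
Qed.

Lemma total_recursive_mull n c (F : n.-tuple nat -> nat) :
  total_recursive F -> total_recursive (fun v => c * F v).
Proof.
move=> Fr; elim: c => [|c IHc]; first by exists (MZero n).
apply: eq_total_recursive (total_recursive_comp2 recursive2_add Fr IHc) => v.
by rewrite mulSn.
Qed.

Lemma recursive_rec0 h : recursive2 h -> recursive (nat_rect (fun=> nat) 0 h).
Proof.
have zr : total_recursive (fun _ : 0.-tuple nat => 0) by exists (MZero 0).
move=> hr; apply/recursiveP.
apply: eq_total_recursive (total_recursive_prec zr hr) => v.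
by elim: (thead v) => //= k ->; rewrite theadE (tnth_nth 0).
Qed.

Lemma recursive_comp (h k : nat -> nat) :
  recursive h -> recursive k -> recursive (h \o k).
Proof.
move=> hr /recursiveP kr; apply/recursiveP; exact: (total_recursive_comp1 hr kr).
Qed.

(** The sum serves as a recursive upper bound for all values of [h] below [l]. *)
Lemma recursive_sum h : recursive h -> recursive (fun l => \sum_(k < l) h k).
Proof.
move=> hr; have [|c cP] := recursive_rec0 (h := fun k u => u + h k).
  apply: total_recursive_comp2 recursive2_add (total_recursive_proj _) _.
  exact: total_recursive_comp1 hr (total_recursive_proj _).
exists c => l; suff -> : \sum_(k < l) h k = nat_rect (fun=> nat) 0
    (fun k u => u + h k) l by [].
by elim: l => [|l IHl] /=; rewrite ?big_ord0 // big_ord_recr /= IHl.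
Qed.

(** * Lengths and codes of words *)

(* The code of [l] letters, all of them the one with the largest digit. *)
Definition word_code_bound n : nat -> nat :=
  nat_rect (fun=> nat) 0 (fun _ b => n.*2 * b.+1).

Lemma recursive_word_code_bound n : recursive (word_code_bound n).
Proof.
apply: recursive_rec0; apply: total_recursive_mull.
exact: total_recursive_comp1 recursive_succ (total_recursive_proj _).
Qed.

Lemma word_code_le n (w : word n) : word_code w <= word_code_bound n (size w).
Proof.
(* [mulnS] splits the bound into the largest digit [n.*2] and the bound for the tail. *)
elim: w => //= -[i b] w IHw; rewrite mulnS leq_add //=.
  by case: b; rewrite ?addn1 ?addn0 -?doubleS ?leq_double // ltn_double.
by rewrite leq_mul2l IHw orbT.
Qed.

(** Each digit is at least 1, and the factor [n.*2] is positive as soon as a letter exists. *)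
Lemma size_le_word_code n (w : word n) : size w <= word_code w.
Proof.
elim: w => //= -[i b] w IHw; rewrite addSn ltnS.
apply: leq_trans IHw (leq_trans _ (leq_addl _ _)).
by rewrite leq_pmull // double_gt0; apply: leq_trans (ltn_ord i).
Qed.

Lemma word_map_size_bound n (f : word n -> word n) :
  computable_word_map f ->
  exists2 phi, recursive phi & forall w, size (f w) <= phi (size w).
Proof.
move=> [h hr hf].
(* [h] may fail to be monotone, so its values at all codes up to the bound are added; the successor
   makes the strict range of the sum include the bound. *)
exists ((fun l => \sum_(k < l) h k) \o (succn \o word_code_bound n)).
  apply: recursive_comp (recursive_sum hr) _.
  exact: recursive_comp recursive_succ (recursive_word_code_bound n).
move=> w; apply: leq_trans (size_le_word_code _) _; rewrite -hf /=.
have wB : word_code w < (word_code_bound n (size w)).+1 by exact: word_code_le.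
by rewrite (bigD1 (Ordinal wB)) //= leq_addr.
Qed.

Local Open Scope group_scope.

(** * Idempotents, natural order and R-classes *)

Section InverseSemigroupTheory.
Variable S : inverseSemigroupType.
Implicit Types s t e m p q : S.

Lemma sinv_of_idem e : is_idem e -> sinv e = e.
Proof. by move=> ee; apply/esym/sinv_unique; rewrite !ee. Qed.

(** Let [y] be the inverse of [e * f]. Then [f * y * e] is also one, so it equals [y], which makes
    [y] idempotent. Hence [y] is its own inverse, and so is equal to [e * f]. *)
Lemma idem_mul e f : is_idem e -> is_idem f -> is_idem (e * f : S).
Proof.
rewrite /is_idem => ee ff.
pose y := sinv (e * f).
have yK : e * (f * (y * (e * f))) = e * f.
  by have := sinv_mulK (e * f); rewrite -/y -!mulgA.
have yVK t : y * (e * (f * (y * t))) = y * t.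
  by have /(congr1 (mulg^~ t)) := sinv_mulVK (e * f); rewrite -/y -!mulgA.
have eK t : e * (e * t) = e * t by rewrite mulgA ee.
have fK t : f * (f * t) = f * t by rewrite mulgA ff.
have yE : f * (y * e) = y.
  by apply: sinv_unique; rewrite -!mulgA ?(eK, fK) ?yK ?yVK.
have yy : y * y = y by rewrite -yE -!mulgA yVK.
have efE : e * f = y.
  rewrite -[RHS](sinv_of_idem yy); apply: sinv_unique.
    exact: sinv_mulVK.
  exact: sinv_mulK.
by rewrite efE.
Qed.

(** The idempotent [e * f] is its own inverse, and [f * e] is an inverse of it too. *)
Lemma idem_comm e f : is_idem e -> is_idem f -> e * f = f * e :> S.
Proof.
move=> ee ff; rewrite -[LHS](sinv_of_idem (idem_mul ee ff)).
have eK t : e * (e * t) = e * t by rewrite mulgA ee.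
have fK t : f * (f * t) = f * t by rewrite mulgA ff.
have := idem_mul ee ff; have := idem_mul ff ee; rewrite /is_idem -!mulgA.
move=> fe ef; apply/esym/sinv_unique; rewrite -!mulgA ?(eK, fK) //.
Qed.

(** If [s = m * e], then [sinv s = e * sinv m], and [e] commutes with the idempotent
    [sinv m * m]. *)
Lemma nat_leE s m : nat_le s m -> s * sinv s * m = s.
Proof.
move=> [e ee ->].
have eK t : e * (e * t) = e * t by rewrite mulgA ee.
have C : e * (sinv m * m) = sinv m * m * e := idem_comm ee (sinv_idemV m).
have C' t : e * (sinv m * (m * t)) = sinv m * (m * (e * t)).
  by rewrite (mulgA _ m t) (mulgA e) C -!mulgA.
have mK t : m * (sinv m * (m * t)) = m * t by rewrite !mulgA sinv_mulK.
have -> : sinv (m * e) = e * sinv m.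
  apply/esym/sinv_unique; rewrite -!mulgA eK; first by rewrite C' mK ee.
  by rewrite C' eK -C' (mulgA (sinv m)) sinv_mulVK.
by rewrite -!mulgA eK C -mulgA mK.
Qed.

Lemma Rrel_idem s : Rrel (s * sinv s) s.
Proof. by rewrite /Rrel (sinv_of_idem (sinv_idem s)) sinv_idem. Qed.

(** Each of the idempotents [s * sinv s] and [t * sinv t] absorbs the other, and they commute. *)
Lemma Rrel_ideal s t p q : s = t * p -> t = s * q -> Rrel s t.
Proof.
move=> sE tE; have ss := sinv_idem s; have tt := sinv_idem t.
have st : t * sinv t * (s * sinv s) = s * sinv s.
  by rewrite {1}sE !mulgA sinv_mulK -sE.
have ts : s * sinv s * (t * sinv t) = t * sinv t.
  by rewrite {1}tE !mulgA sinv_mulK -tE.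
by rewrite /Rrel -st idem_comm // ts.
Qed.

(** Right ideals shrink along a product, so if the last one equals the first, all between are equal.
    This keeps paths inside an R-class. *)
Lemma Rrel_prefix s t p : Rrel s (s * t * p) -> Rrel s (s * t).
Proof.
move=> /eqP sE; apply: (@Rrel_ideal s _ (p * sinv (s * t * p) * s) t) => //.
by rewrite !mulgA -[LHS]sinv_mulK sE.
Qed.

(** All idempotents lie below [m]. For [m * sinv m] this gives [m = m * sinv m], so [m] is
    idempotent; it then fixes [t] through [t * sinv t] and [sinv t * t]. *)
Lemma sigma_max_idem m e : is_idem e -> sigma_max e m ->
  forall t : S, m * t = t /\ t * m = t.
Proof.
move=> ee [_ mmax].
have fM f : is_idem f -> f * m = f.
  move=> ff; have /nat_leE : nat_le f m by apply: mmax; rewrite !sigma_idem.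
  by rewrite sinv_of_idem // ff.
have mm : is_idem m.
  have mE := fM _ (sinv_idem m); rewrite sinv_mulK in mE.
  by rewrite mE; apply: sinv_idem.
move=> t; split.
  by rewrite -[t in LHS]sinv_mulK mulgA (idem_comm mm (sinv_idem t))
    (fM _ (sinv_idem t)) sinv_mulK.
by rewrite -[t in LHS]sinv_mulK -!mulgA (mulgA _ t) (fM _ (sinv_idemV t)) mulgA
  sinv_mulK.
Qed.

Lemma sigmaV s : sigma (sinv s) = (sigma s)^-1.
Proof.
apply: (mulIg (sigma s)); rewrite mulVg -[LHS](sigma_mul (sinv s) s).
exact/sigma_idem/sinv_idemV.
Qed.

(** * Words as paths in the Cayley graph *)

Section Generators.
Variables (n : nat) (x : 'I_n -> S).
(** The endpoint of the path with a given label; a base point treats the empty word uniformly. *)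
Local Notation run := (foldl (fun t b => t * letter_val x b)).

Lemma run_mul s t (w : word n) : run (s * t) w = s * run t w.
Proof. by elim: w t => //= a w IHw t; rewrite -mulgA IHw. Qed.

Lemma run_represents (w : word n) m t : represents x w m -> run t w = t * m.
Proof.
case: w => [/(_ t)[]//|a w /= <-]; exact: run_mul.
Qed.

Lemma sigma_run t (w : word n) :
  sigma (run t w) = sigma t * group_word_val (fun i => sigma (x i)) w.
Proof.
elim: w t => [|a w IHw] t /=; first by rewrite mulg1.
rewrite IHw mulgA [sigma (_ * _)]sigma_mul; congr (_ * _ * _).
by rewrite /letter_val; case: ifP => // _; rewrite sigmaV.
Qed.

Lemma sigma_represents (w : word n) s : represents x w s ->
  sigma s = group_word_val (fun i => sigma (x i)) w.
Proof.
move=> ws; apply: (mulgI (sigma s)); rewrite -sigma_run (run_represents _ ws).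
exact/esym/sigma_mul.
Qed.

(** The empty word needs an identity, which the maximum above an idempotent provides. *)
Lemma represents_exists (w : word n) : F_inverse S -> exists s, represents x w s.
Proof.
case: w => [|a w] FS; last by exists (run (letter_val x a) w).
case: (@semigroup_inhabited S) => s; have [m] := FS (s * sinv s).
by exists m; apply: sigma_max_idem (sinv_idem s) _.
Qed.

Lemma run_path s t (w : word n) : Rrel s t -> Rrel s (run t w) ->
  exists p : seq S,
    [/\ path (fun u v => [&& cayley_edge x u v, Rrel s u & Rrel s v]) t p,
        last t p = run t w & size p = size w].
Proof.
elim: w t => [|a w IHw] t st sw /=; first by exists [::].
have sa : Rrel s (t * letter_val x a).
  (* With [r = t * letter_val x a], the identity [r * (sinv r * r) = r] writes the endpoint
     [run r w] as a right multiple of [r]. *)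
  rewrite /Rrel (eqP st); apply: (@Rrel_prefix _ _
    (run (sinv (t * letter_val x a) * (t * letter_val x a)) w)).
  rewrite -run_mul mulgA sinv_mulK.
  by rewrite /Rrel -(eqP st).
have [p [pP pl ps]] := IHw _ sa sw.
exists (t * letter_val x a :: p); rewrite /= pP pl ps; split=> //.
by rewrite st sa !andbT; apply/existsP; exists a.
Qed.

Lemma word_length_le s m (w : word n) : nat_le s m -> represents x w m ->
  exists2 k, word_length x s = Some k & (k <= size w)%N.
Proof.
move=> /nat_leE sE wm; set e := s * sinv s in sE *.
have es : Rrel e s := Rrel_idem s.
have runE : run e w = s by rewrite (run_represents _ wm).
have [] := @run_path e e w; rewrite ?runE //; first exact: eqxx.
move=> p [pP pl ps]; rewrite /word_length /word_dist -/e es.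
have [|k [-> _ kw]] := @least_le (fun k => exists p : seq S,
  [/\ path (fun u v => [&& cayley_edge x u v, Rrel e u & Rrel e v]) e p,
      last e p = s & size p = k]) (size w); last by exists k.
by exists p.
Qed.

End Generators.
End InverseSemigroupTheory.

Theorem proposition5p4 (S : inverseSemigroupType) (n : nat) (x : 'I_n -> S)
  (x_gen : generates x)
  (S_effF : effectively_F_inverse x)
  (G_wp : decidable_word_problem (max_group_image S)) :
  recursively_bounded_group_distortion x.
Proof.
case: S_effF => FS [f f_comp fP].
have [phi phi_rec phi_le] := word_map_size_bound f_comp.
exists phi => // s; have [w ws] := x_gen s.
have [|l [lE [u uE ul] _]] := @least_le (fun k => exists2 w,
  group_word_val (fun i => sigma (x i)) w = sigma s & size w = k) (size w).
  by exists w => //; rewrite -(sigma_represents ws).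
(* [u] need not represent [s], only some [t] in the same sigma-class; the maximum of that class is
   still above [s]. *)
have [t ut] := represents_exists x u FS; have [m tm] := FS t.
have st : sigma t = sigma s by rewrite (sigma_represents ut).
have [_ /(_ _ st) sm] := tm.
have [k kE kf] := word_length_le sm (fP _ _ _ ut tm).
by exists k, l; split=> //; rewrite -ul; apply: leq_trans kf (phi_le u).
Qed.
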